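(* Let $h\in\mathcal{H}(n)$ be a Hessenberg function and let $1\le d_0<d<n$ be such that $h(d)=h(d+1)$ and $h^{-1}(d)=\{d_0\}$, with associated $h_-,h_+$ and labeled graphs $\mathcal{G}_-,\mathcal{G},\mathcal{G}_+,{}^\circ\mathcal{G},\widetilde{\mathcal{G}}$ as defined in the context. Then the homomorphisms $$\varphi+\psi_!\colon H^*_T({}^\circ\mathcal{G})\oplus H^{*-2}_T(\mathcal{G})\to H^*_T(\widetilde{\mathcal{G}},s),\qquad (\varphi+\psi_!)(f,g)=\varphi(f)+\psi_!(g)$$ and $$\eta+\rho_!\colon H^*_T(\mathcal{G}_+)\oplus H^{*-2}_T(\mathcal{G}_-)\to H^*_T(\widetilde{\mathcal{G}},s),\qquad (\eta+\rho_!)(f_+,f_-)=\eta(f_+)+\rho_!(f_-)$$ are both isomorphisms of $\mathfrak{S}_n$-modules.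
   Context: Let $[n]=\{1,\dots,n\}$ and let $\mathfrak{S}_n$ be the symmetric group on $[n]$. A Hessenberg function is a non-decreasing map $h\colon[n]\to[n]$ with $h(j)\ge j$ for all $j$; $\mathcal{H}(n)$ is the set of them. Put $H^*(BT)=\mathbb{C}[t_1,\dots,t_n]$ with each $t_i$ in degree $2$; $\sigma\in\mathfrak{S}_n$ acts on it by $t_i\mapsto t_{\sigma(i)}$. $(i,j)$ denotes a transposition, and products in $\mathfrak{S}_n$ are compositions of maps. Labeled graphs and graph cohomology: a labeled graph $\Gamma=(V,E,\alpha)$ has vertex set $V$, edge set $E$ and labeling $\alpha\colon E\to H^2(BT)$ (labels matter only up to sign). Its graph cohomology is $H^*_T(\Gamma)=\{f\in\mathrm{Map}(V,H^*(BT))\mid f(e_+)\equiv f(e_-)\pmod{\alpha(e)}\ \text{for all } e\in E\}$, where $e_\pm$ are the endpoints of $e$; it is graded by degree, and is an $H^*(BT)$-algebra under pointwise operations. $H^{*-2}_T$ denotes the degree shift by $2$. Setting: given $h,d,d_0$ with $1\le d_0<d<n$, $h(d)=h(d+1)$, $h^{-1}(d)=\{d_0\}$, define $h_-$ and $h_+$ by $h_-(d_0)=d-1$, $h_+(d_0)=d+1$ and $h_\pm(j)=h(j)$ for $j\ne d_0$. For a Hessenberg function $k$, let $\mathcal{G}_X(k)$ be the labeled graph with vertex set $\mathfrak{S}_n$, edges $\{w,w(i,j)\}$ for $w\in\mathfrak{S}_n$ and $j<i\le k(j)$, and label $t_{w(i)}-t_{w(j)}$ on $\{w,w(i,j)\}$.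 Put $\mathcal{G}_-=\mathcal{G}_X(h_-)$, $\mathcal{G}=\mathcal{G}_X(h)$, $\mathcal{G}_+=\mathcal{G}_X(h_+)$. The labeled graph ${}^\circ\mathcal{G}$ has vertex set $\{{}^\circ w\mid w\in\mathfrak{S}_n\}$ (${}^\circ w$ is a copy of $w$), edges $\{{}^\circ w,{}^\circ w(i,j)\}$ for $w\in\mathfrak{S}_n$ and $(i,j)$ with $j<i\le h_-(j)$ or $(i,j)=(d+1,d_0)$, with label $t_{w(i)}-t_{w(j)}$. Here ${}^\circ w\sigma$ means the copy of $w\sigma$. The labeled graph $\widetilde{\mathcal{G}}$ has vertex set $V(\mathcal{G})\sqcup V({}^\circ\mathcal{G})$ and edge set $E(\mathcal{G})\cup E({}^\circ\mathcal{G})\cup\{\{w,{}^\circ w\}\mid w\in\mathfrak{S}_n\}$, where edges of $\mathcal{G}$ and ${}^\circ\mathcal{G}$ keep their labels and $\{w,{}^\circ w\}$ has label $t_{w(d+1)}-t_{w(d)}$. Let $\tau=(d+1,d)$, and let $s\colon V(\widetilde{\mathcal{G}})\to\{\pm1\}$ be $s(w)=+1$, $s({}^\circ w)=-1$. Define $H^*_T(\widetilde{\mathcal{G}},s)$ to be the set of $f\in H^*_T(\widetilde{\mathcal{G}})$ with $$f(w)-f({}^\circ w)+f(w\tau)-f({}^\circ w\tau)\equiv0\pmod{(t_{w(d+1)}-t_{w(d)})^2}\quad\text{for all }w\in\mathfrak{S}_n.$$ The dot action of $\sigma\in\mathfrak{S}_n$ is $(\sigma\cdot f)(w)=\sigma(f(\sigma^{-1}w))$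 and $(\sigma\cdot f)({}^\circ w)=\sigma(f({}^\circ\sigma^{-1}w))$; this is the $\mathfrak{S}_n$-module structure on $H^*_T(\mathcal{G}_-)$, $H^*_T(\mathcal{G})$, $H^*_T(\mathcal{G}_+)$, $H^*_T({}^\circ\mathcal{G})$ and $H^*_T(\widetilde{\mathcal{G}},s)$. The four maps, all with values in $H^*_T(\widetilde{\mathcal{G}},s)$ and defined for all $w\in\mathfrak{S}_n$, are: (1) $\varphi\colon H^*_T({}^\circ\mathcal{G})\to H^*_T(\widetilde{\mathcal{G}},s)$, $\varphi(f)(w)=f({}^\circ w\tau)$, $\varphi(f)({}^\circ w)=f({}^\circ w)$; (2) $\psi_!\colon H^{*-2}_T(\mathcal{G})\to H^*_T(\widetilde{\mathcal{G}},s)$, $\psi_!(f)(w)=(t_{w(d+1)}-t_{w(d)})f(w)$, $\psi_!(f)({}^\circ w)=0$; (3) $\eta\colon H^*_T(\mathcal{G}_+)\to H^*_T(\widetilde{\mathcal{G}},s)$, $\eta(f)(w)=\eta(f)({}^\circ w)=f(w)$; (4) $\rho_!\colon H^{*-2}_T(\mathcal{G}_-)\to H^*_T(\widetilde{\mathcal{G}},s)$, $\rho_!(f)(w)=(t_{w(d)}-t_{w(d_0)})f(w)$, $\rho_!(f)({}^\circ w)=(t_{w(d+1)}-t_{w(d_0)})f(w)$. *)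

(* Defs.v *)
From HB Require Import structures.
From mathcomp Require Import all_boot all_order all_algebra all_fingroup.
From mathcomp Require Import boolp classical_sets functions reals.
From mathcomp Require Import complex mpoly.

Set Implicit Arguments.
Unset Strict Implicit.
Unset Printing Implicit Defensive.

Import GRing.Theory.
Local Open Scope ring_scope.

(* The index set {1, ..., n} is 'I_n = {0, ..., n-1}, i.e. every index is
   shifted down by one.  The complex numbers are R[i] for R : realType. *)

(* H^*(BT) = C[t_1, ..., t_n]; the generator t_i, of cohomological degree 2, has
   polynomial degree 1, so H^{2k}(BT) consists of the p with p \is k.-homog. *)
Notation HBT R n := {mpoly R[i][n]}.

(* Product of permutations as a composition of maps: (u \oS v) i = u (v i).
   The group law of {perm _} composes in the opposite order. *)
Definition permc (n : nat) (u v : 'S_n) : 'S_n := (v * u)%g.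
Notation "u \oS v" := (permc u v) (at level 40, left associativity).

Lemma permcE (n : nat) (u v : 'S_n) (i : 'I_n) : (u \oS v) i = u (v i).
Proof. exact: permM. Qed.

Lemma permcA (n : nat) (u v w : 'S_n) : u \oS (v \oS w) = u \oS v \oS w.
Proof. by apply/permP => i; rewrite !permcE. Qed.

(* The action of s on H^*(BT) is msym s. *)
Lemma msym_var (R : realType) (n : nat) (s : 'S_n) (i : 'I_n) :
  msym s ('X_i : {mpoly R[i][n]}) = 'X_(s i).
Proof.
rewrite msymX; congr mpolyX; apply/mnmP => j; rewrite mnmE !mnm1E.
by rewrite -(inj_eq (@perm_inj _ s)) permKV.
Qed.

Definition eqmodp (A : nzRingType) (a p q : A) : Prop :=
  exists c : A, p - q = c * a.

(* Graded S_n-modules over C, presented as a submodule [gcarrier] of an ambient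
   vector space [gamb].  [gdeg k] is the homogeneous part of cohomological
   degree 2k (all the odd parts vanish). *)
Record gSnmodule (R : realType) (n : nat) := GSnModule {
  gamb : lmodType R[i];
  gcarrier : set gamb;
  gdeg : nat -> set gamb;
  gact : 'S_n -> gamb -> gamb;
  gcarrier0 : gcarrier 0;
  gcarrierP : forall (a : R[i]) (x y : gamb),
    gcarrier x -> gcarrier y -> gcarrier (a *: x + y);
  gdeg_sub : forall k : nat, (gdeg k `<=` gcarrier)%classic;
  gact_stable : forall (s : 'S_n) (x : gamb), gcarrier x -> gcarrier (gact s x);
  gact_linear : forall (s : 'S_n) (a : R[i]) (x y : gamb),
    gact s (a *: x + y) = a *: gact s x + gact s y;
  gact1 : forall x : gamb, gact 1%g x = x;
  gactM : forall (s t : 'S_n) (x : gamb), gact (s \oS t) x = gact s (gact t x);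
  gact_deg : forall (s : 'S_n) (k : nat) (x : gamb),
    gdeg k x -> gdeg k (gact s x)
}.

Record gSn_isomorphism (R : realType) (n : nat) (M N : gSnmodule R n)
    (F : gamb M -> gamb N) : Prop := GSnIsomorphism {
  giso_linear : forall (a : R[i]) (x y : gamb M), gcarrier x -> gcarrier y ->
    F (a *: x + y) = a *: F x + F y;
  giso_equivariant : forall (s : 'S_n) (x : gamb M), gcarrier x ->
    F (gact s x) = gact s (F x);
  giso_deg : forall (k : nat) (x : gamb M), gdeg k x -> gdeg k (F x);
  giso_bij : set_bij (@gcarrier R n M) (@gcarrier R n N) F
}.

Section Constructions.
Variables (R : realType) (n : nat).

Program Definition gsum (M N : gSnmodule R n) : gSnmodule R n :=
  @GSnModule R n (gamb M * gamb N)%type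
    (@gcarrier R n M `*` @gcarrier R n N)%classic
    (fun k => @gdeg R n M k `*` @gdeg R n N k)%classic
    (fun s x => (gact s x.1, gact s x.2)) _ _ _ _ _ _ _ _.
Next Obligation. by split; exact: gcarrier0. Qed.
Next Obligation. by split; exact: gcarrierP. Qed.
Next Obligation. by move=> x [? ?]; split; apply: gdeg_sub; eassumption. Qed.
Next Obligation. by split; exact: gact_stable. Qed.
Next Obligation. by rewrite !gact_linear. Qed.
Next Obligation. by rewrite !gact1. Qed.
Next Obligation. by rewrite !gactM. Qed.
Next Obligation. by split; exact: gact_deg. Qed.

(* M^{*-2}: its part of degree 2k is the part of degree 2k-2 of M. *)
Program Definition gshift (M : gSnmodule R n) : gSnmodule R n :=
  @GSnModule R n (gamb M) (@gcarrier R n M)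
    (fun k => if k is k'.+1 then @gdeg R n M k' else [set 0])%classic
    (@gact R n M) _ _ _ _ _ _ _ _.
Next Obligation. exact: gcarrier0. Qed.
Next Obligation. exact: gcarrierP. Qed.
Next Obligation.
case: k => [|k]; last exact: gdeg_sub.
by move=> _ ->; exact: gcarrier0.
Qed.
Next Obligation. exact: gact_stable. Qed.
Next Obligation. exact: gact_linear. Qed.
Next Obligation. exact: gact1. Qed.
Next Obligation. exact: gactM. Qed.
Next Obligation.
case: k H => [->|k]; last exact: gact_deg.
have := gact_linear s (-1) (0 : gamb M) 0.
by rewrite scaler0 addr0 scaleN1r addNr.
Qed.

End Constructions.

(* The labels being relevant up to sign only, an edge may be listed several
   times, with both orientations and opposite labels. *)
Record lgraph (R : realType) (n : nat) := LGraph {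
  vert : finType;
  edge : Type;
  eplus : edge -> vert;
  eminus : edge -> vert;
  elabel : edge -> HBT R n;
  elabel_deg : forall e : edge, elabel e \is 1.-homog
}.

(* Map(V, H^*(BT)) *)
Notation cochain R n G := {ffun @vert R%type n G -> HBT R n}.

Definition HT (R : realType) (n : nat) (G : lgraph R n) : set (cochain R n G) :=
  [set f : cochain R n G |
    forall e : edge G, eqmodp (elabel e) (f (eplus e)) (f (eminus e))]%classic.

Definition homogeneous (R : realType) (n : nat) (G : lgraph R n) (k : nat) :
    set (cochain R n G) :=
  [set f : cochain R n G | forall v, f v \is k.-homog]%classic.

(* Left actions of S_n on a labeled graph, semi-linear on the labels. *)
Record lgraph_action (R : realType) (n : nat) (G : lgraph R n) :=
  LGraphAction {
  vact : 'S_n -> vert G -> vert G;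
  vact1 : forall v, vact 1%g v = v;
  vactM : forall s t v, vact (s \oS t) v = vact s (vact t v);
  vact_edge : forall (s : 'S_n) (e : edge G), exists e' : edge G,
    [/\ eplus e' = vact s (eplus e), eminus e' = vact s (eminus e)
      & elabel e' = msym s (elabel e)]
}.

Definition dot (R : realType) (n : nat) (G : lgraph R n) (a : lgraph_action G)
    (s : 'S_n) (f : cochain R n G) : cochain R n G :=
  [ffun v => msym s (f (vact a s^-1%g v))].

Section HTModule.
Variables (R : realType) (n : nat) (G : lgraph R n) (a : lgraph_action G).

Lemma dotE (s : 'S_n) (f : cochain R n G) (v : vert G) :
  dot a s f v = msym s (f (vact a s^-1%g v)).
Proof. by rewrite /dot ffunE. Qed.

Lemma HT0 : HT (0 : cochain R n G).
Proof. by move=> e; exists 0; rewrite !ffunE subrr mul0r. Qed.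

Lemma HTP (c : R[i]) (f g : cochain R n G) : HT f -> HT g -> HT (c *: f + g).
Proof.
move=> Hf Hg e; have [p Ep] := Hf e; have [q Eq] := Hg e.
exists (c *: p + q); rewrite !ffunE mulrDl -scalerAl -Ep -Eq.
by rewrite scalerBr opprD addrACA.
Qed.

Lemma dot_stable (s : 'S_n) (f : cochain R n G) : HT f -> HT (dot a s f).
Proof.
move=> Hf e; have [e' [Ep Em El]] := vact_edge a s^-1%g e.
have [p Ep'] := Hf e'; exists (msym s p).
rewrite !dotE -Ep -Em -msymB Ep' msymM El.
by rewrite -msymMm mulVg msym1m.
Qed.

Lemma dot_linear (s : 'S_n) (c : R[i]) (f g : cochain R n G) :
  dot a s (c *: f + g) = c *: dot a s f + dot a s g.
Proof.
apply/ffunP => v; rewrite [RHS]ffunE [LHS]ffunE [X in msym _ X]ffunE.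
rewrite [X in _ = X + _]ffunE [X in msym _ (X + _)]ffunE msymD msymZ.
by congr (_ *: _ + _); rewrite ffunE.
Qed.

Lemma dot1 (f : cochain R n G) : dot a 1%g f = f.
Proof. by apply/ffunP => v; rewrite !ffunE invg1 vact1 msym1m. Qed.

Lemma dotM (s t : 'S_n) (f : cochain R n G) :
  dot a (s \oS t) f = dot a s (dot a t f).
Proof.
apply/ffunP => v; apply: etrans (dotE _ _ _) _.
apply/esym; apply: etrans (dotE _ _ _) _.
apply: etrans (congr1 (msym s) (dotE _ _ _)) _; rewrite -(vactM a).
have -> : t^-1%g \oS s^-1%g = (s \oS t)^-1%g by rewrite /permc invMg.
exact/esym/msymMm.
Qed.

Lemma dot_homog (s : 'S_n) (k : nat) (f : cochain R n G) :
  homogeneous k f -> homogeneous k (dot a s f).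
Proof.
move=> Hf v; rewrite dotE; move: (Hf (vact a s^-1%g v)).
by rewrite !homog_piE -msym_pihomog => /eqP ->.
Qed.

Definition HT_deg (k : nat) : set (cochain R n G) :=
  (HT (G := G) `&` homogeneous (G := G) k)%classic.

Lemma HT_deg_sub (k : nat) : (HT_deg k `<=` HT (G := G))%classic.
Proof. by move=> f []. Qed.

Lemma HT_deg_dot (s : 'S_n) (k : nat) (f : cochain R n G) :
  HT_deg k f -> HT_deg k (dot a s f).
Proof. by case=> Hf hf; split; [exact: dot_stable|exact: dot_homog]. Qed.

Definition HT_module : gSnmodule R n :=
  GSnModule HT0 HTP HT_deg_sub dot_stable dot_linear dot1 dotM HT_deg_dot.

(* The module cut out of H_T^*(G) by an S_n-stable linear condition P. *)
Section Sub.
Variables (P : set (cochain R n G)) (P0 : P 0).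
Hypothesis PP : forall (c : R[i]) (f g : cochain R n G),
  P f -> P g -> P (c *: f + g).
Hypothesis Pdot : forall (s : 'S_n) (f : cochain R n G), P f -> P (dot a s f).

Definition HTsub : set (cochain R n G) := (HT (G := G) `&` P)%classic.

Definition HTsub_deg (k : nat) : set (cochain R n G) :=
  (HTsub `&` homogeneous (G := G) k)%classic.

Lemma HTsub0 : HTsub 0.
Proof. by split; [exact: HT0|]. Qed.

Lemma HTsubP (c : R[i]) (f g : cochain R n G) :
  HTsub f -> HTsub g -> HTsub (c *: f + g).
Proof. by case=> Hf Pf [Hg Pg]; split; [exact: HTP|exact: PP]. Qed.

Lemma HTsub_deg_sub (k : nat) : (HTsub_deg k `<=` HTsub)%classic.
Proof. by move=> f []. Qed.

Lemma HTsub_dot (s : 'S_n) (f : cochain R n G) : HTsub f -> HTsub (dot a s f).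
Proof. by case=> Hf Pf; split; [exact: dot_stable|exact: Pdot]. Qed.

Lemma HTsub_deg_dot (s : 'S_n) (k : nat) (f : cochain R n G) :
  HTsub_deg k f -> HTsub_deg k (dot a s f).
Proof. by case=> Hf hf; split; [exact: HTsub_dot|exact: dot_homog]. Qed.

Definition HTsub_module : gSnmodule R n :=
  GSnModule HTsub0 HTsubP HTsub_deg_sub HTsub_dot dot_linear dot1 dotM
    HTsub_deg_dot.

End Sub.

End HTModule.

Section Graphs.
Variables (R : realType) (n : nat).

Definition hessenberg (h : 'I_n -> 'I_n) : Prop :=
  {homo h : i j / (i <= j)%N} /\ (forall j : 'I_n, (j <= h j)%N).

Definition tdiff (w : 'S_n) (i j : 'I_n) : HBT R n := 'X_(w i) - 'X_(w j).

Lemma tdiff_deg (w : 'S_n) (i j : 'I_n) : tdiff w i j \is 1.-homog.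
Proof. by rewrite rpredB // dhomogX; apply/eqP/mdeg1. Qed.

Lemma tdiff_tperm (w : 'S_n) (i j : 'I_n) :
  tdiff (w \oS tperm i j) i j = - tdiff w i j.
Proof. by rewrite /tdiff !permcE tpermL tpermR opprB. Qed.

Lemma msym_tdiff (s w : 'S_n) (i j : 'I_n) :
  msym s (tdiff w i j) = tdiff (s \oS w) i j.
Proof. by rewrite msymB !msym_var /tdiff !permcE. Qed.

(* The graph on S_n with an edge {w, w(i,j)}, of label t_{w(i)} - t_{w(j)}, for
   each w and each (i, j) such that P i j.  When P i j excludes P j i, each edge
   is listed exactly twice, from w and from w(i,j): see tdiff_tperm. *)
Record perm_edge (P : rel 'I_n) := PermEdge {
  pe_w : 'S_n; pe_i : 'I_n; pe_j : 'I_n; pe_P : P pe_i pe_j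
}.

Definition perm_graph (P : rel 'I_n) : lgraph R n :=
  @LGraph R n 'S_n (perm_edge P)
    (fun e => pe_w e) (fun e => pe_w e \oS tperm (pe_i e) (pe_j e))
    (fun e => tdiff (pe_w e) (pe_i e) (pe_j e))
    (fun e => tdiff_deg (pe_w e) (pe_i e) (pe_j e)).

Definition hess_rel (k : 'I_n -> 'I_n) : rel 'I_n :=
  fun i j => (j < i <= k j)%N.

Definition graphX (k : 'I_n -> 'I_n) : lgraph R n := perm_graph (hess_rel k).

Definition ord_predn (d : 'I_n) : 'I_n :=
  Ordinal (leq_ltn_trans (leq_pred d) (ltn_ord d)).

(* d1 stands for d + 1 in what follows. *)
Definition h_minus (h : 'I_n -> 'I_n) (d0 d : 'I_n) : 'I_n -> 'I_n :=
  fun j => if j == d0 then ord_predn d else h j.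

Definition h_plus (h : 'I_n -> 'I_n) (d0 d1 : 'I_n) : 'I_n -> 'I_n :=
  fun j => if j == d0 then d1 else h j.

Definition graphO (h : 'I_n -> 'I_n) (d0 d d1 : 'I_n) : lgraph R n :=
  perm_graph (fun i j =>
    hess_rel (h_minus h d0 d) i j || ((i == d1) && (j == d0))).

(* In 'S_n + 'S_n, inl w is the vertex w and inr w is its copy. *)
Section Tilde.
Variables (h : 'I_n -> 'I_n) (d0 d d1 : 'I_n).

Let GX := graphX h.
Let GO := graphO h d0 d d1.

Definition tilde_edge : Type := (edge GX + edge GO + 'S_n)%type.

Definition tilde_plus (e : tilde_edge) : 'S_n + 'S_n :=
  match e with
  | inl (inl e) => inl (eplus e)
  | inl (inr e) => inr (eplus e)
  | inr w => inl w
  end.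

Definition tilde_minus (e : tilde_edge) : 'S_n + 'S_n :=
  match e with
  | inl (inl e) => inl (eminus e)
  | inl (inr e) => inr (eminus e)
  | inr w => inr w
  end.

Definition tilde_label (e : tilde_edge) : HBT R n :=
  match e with
  | inl (inl e) => elabel e
  | inl (inr e) => elabel e
  | inr w => tdiff w d1 d
  end.

Lemma tilde_label_deg (e : tilde_edge) : tilde_label e \is 1.-homog.
Proof. by case: e => [[e|e]|w]; exact: tdiff_deg. Qed.

Definition graphT : lgraph R n :=
  @LGraph R n ('S_n + 'S_n)%type tilde_edge
    tilde_plus tilde_minus tilde_label tilde_label_deg.

End Tilde.

Lemma permc1l (w : 'S_n) : 1%g \oS w = w. Proof. exact: mulg1. Qed.

Lemma permcAr (s t w : 'S_n) : (s \oS t) \oS w = s \oS (t \oS w).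
Proof. by rewrite permcA. Qed.

Lemma perm_graph_vact_edge (P : rel 'I_n) (s : 'S_n)
    (e : edge (perm_graph P)) :
  exists e' : edge (perm_graph P),
    [/\ eplus e' = s \oS eplus e, eminus e' = s \oS eminus e
      & elabel e' = msym s (elabel e)].
Proof.
case: e => w i j Pij; exists (PermEdge (s \oS w) Pij).
by split=> //=; [rewrite permcA | rewrite msym_tdiff].
Qed.

Definition perm_action (P : rel 'I_n) : lgraph_action (perm_graph P) :=
  @LGraphAction R n (perm_graph P) (fun s w => s \oS w)
    permc1l permcAr (@perm_graph_vact_edge P).

Section TildeAction.
Variables (h : 'I_n -> 'I_n) (d0 d d1 : 'I_n).
Let GT := graphT h d0 d d1.

Definition tilde_vact (s : 'S_n) (v : 'S_n + 'S_n) : 'S_n + 'S_n :=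
  match v with inl w => inl (s \oS w) | inr w => inr (s \oS w) end.

Lemma tilde_vact1 v : tilde_vact 1%g v = v.
Proof. by case: v => w; rewrite /= permc1l. Qed.

Lemma tilde_vactM s t v :
  tilde_vact (s \oS t) v = tilde_vact s (tilde_vact t v).
Proof. by case: v => w; rewrite /= permcA. Qed.

Lemma tilde_vact_edge (s : 'S_n) (e : edge GT) : exists e' : edge GT,
    [/\ eplus e' = tilde_vact s (eplus e), eminus e' = tilde_vact s (eminus e)
      & elabel e' = msym s (elabel e)].
Proof.
case: e => [[e|e]|w].
- have [e' [Ep Em El]] := perm_graph_vact_edge s e.
  exists (inl (inl e')); split; last exact: El.
    by move: Ep => /= ->.
  by move: Em => /= ->.
- have [e' [Ep Em El]] := perm_graph_vact_edge s e.
  exists (inl (inr e')); split; last exact: El.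
    by move: Ep => /= ->.
  by move: Em => /= ->.
- by exists (inr (s \oS w)); rewrite /= msym_tdiff.
Qed.

Definition tilde_action : lgraph_action GT :=
  @LGraphAction R n GT tilde_vact tilde_vact1 tilde_vactM tilde_vact_edge.

(* The condition cutting H_T^*(graphT, s) out of H_T^*(graphT). *)
Definition tilde_cond : set (cochain R n GT) :=
  [set f : cochain R n GT | forall w : 'S_n,
    eqmodp (tdiff w d1 d ^+ 2)
      (f (inl w) - f (inr w)
       + f (inl (w \oS tperm d1 d)) - f (inr (w \oS tperm d1 d))) 0]%classic.

Lemma tilde_cond0 : tilde_cond 0.
Proof. by move=> w; exists 0; rewrite !ffunE !subr0 addr0 mul0r. Qed.

Lemma tilde_condP (c : R[i]) (f g : cochain R n GT) :
  tilde_cond f -> tilde_cond g -> tilde_cond (c *: f + g).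
Proof.
move=> Hf Hg w; have [p Ep] := Hf w; have [q Eq] := Hg w.
have EE v : (c *: f + g) v = c *: f v + g v.
  by rewrite [LHS]ffunE [X in X + _]ffunE.
exists (c *: p + q); rewrite mulrDl -scalerAl -Ep -Eq !EE !subr0.
set f1 := f _; set f2 := f _; set f3 := f _; set f4 := f _.
rewrite !(scalerBr, scalerDr) !opprD (addrACA (c *: f1)).
by rewrite (addrACA (c *: f1 - c *: f2)) (addrACA (c *: f1 - c *: f2 + c *: f3)).
Qed.

Lemma tilde_cond_dot (s : 'S_n) (f : cochain R n GT) :
  tilde_cond f -> tilde_cond (dot tilde_action s f).
Proof.
move=> Hf w; have [p Ep] := Hf (s^-1%g \oS w).
exists (msym s p).
have -> : tdiff w d1 d ^+ 2 = msym s (tdiff (s^-1%g \oS w) d1 d ^+ 2).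
  by rewrite !expr2 msymM msym_tdiff permcA /permc mulVg mulg1.
rewrite -(msymM s p) -Ep !subr0 msymB msymD msymB.
by rewrite !dotE /= !permcA.
Qed.

End TildeAction.

Definition HX (k : 'I_n -> 'I_n) : gSnmodule R n :=
  HT_module (perm_action (hess_rel k)).

Definition HO (h : 'I_n -> 'I_n) (d0 d d1 : 'I_n) : gSnmodule R n :=
  HT_module (G := graphO h d0 d d1) (perm_action _).

Definition HTs (h : 'I_n -> 'I_n) (d0 d d1 : 'I_n) : gSnmodule R n :=
  HTsub_module (@tilde_cond0 h d0 d d1) (@tilde_condP h d0 d d1)
    (@tilde_cond_dot h d0 d d1).

(* The four maps, given by their formulas on all of Map(S_n, H^*(BT)). *)
Section Maps.
Variables (d0 d d1 : 'I_n).
Implicit Types (f g : {ffun 'S_n -> HBT R n}).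

Definition phi f : {ffun 'S_n + 'S_n -> HBT R n} :=
  [ffun v => match v with inl w => f (w \oS tperm d1 d) | inr w => f w end].

Definition psi_shriek f : {ffun 'S_n + 'S_n -> HBT R n} :=
  [ffun v => match v with inl w => tdiff w d1 d * f w | inr w => 0 end].

Definition eta f : {ffun 'S_n + 'S_n -> HBT R n} :=
  [ffun v => match v with inl w => f w | inr w => f w end].

Definition rho_shriek f : {ffun 'S_n + 'S_n -> HBT R n} :=
  [ffun v => match v with
             | inl w => tdiff w d d0 * f w
             | inr w => tdiff w d1 d0 * f w
             end].

End Maps.

Definition phi_psi (h : 'I_n -> 'I_n) (d0 d d1 : 'I_n)
    (x : gamb (gsum (HO h d0 d d1) (gshift (HX h)))) :
    gamb (HTs h d0 d d1) :=
  phi d d1 x.1 + psi_shriek d d1 x.2.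

Definition eta_rho (h : 'I_n -> 'I_n) (d0 d d1 : 'I_n)
    (x : gamb (gsum (HX (h_plus h d0 d1)) (gshift (HX (h_minus h d0 d))))) :
    gamb (HTs h d0 d d1) :=
  eta x.1 + rho_shriek d0 d d1 x.2.

End Graphs.

(* Main.v *)
Require Import Defs.
From mathcomp Require Import all_boot all_order all_algebra all_fingroup.
From mathcomp Require Import boolp classical_sets functions reals.
From mathcomp Require Import complex mpoly.
From mathcomp Require Import ring zify.

Set Implicit Arguments.
Unset Strict Implicit.
Unset Printing Implicit Defensive.

Import GRing.Theory.
Local Open Scope ring_scope.

(** Write x_i for t_(w(i)), a = x_d1 - x_d, b = x_d - x_d0, c = x_d1 - x_d0,
    so that c = a + b, and let tau = (d1,d).  The hypotheses on h say that h_-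
    is invariant under tau, contains the edges (d1,d), and that
    - h is h_- with (d,d0) added, and the copy graph is h_- with (d1,d0) added,
      so that tau exchanges these two;
    - h_+ is h_- with both (d,d0) and (d1,d0) added.

    That the four maps take values in the signed cohomology is then a direct
    check: for [phi] the exchange by tau is what is needed ([hess_rel_tperm]),
    labels are compatible with every edge ([edge_ok_tdiff]), the extra
    edge (d,d0) or (d1,d0) has b or c as its label, and the condition modulo a^2
    for [psi_shriek] and [rho_shriek] follows from the edges (d1,d).

    Conversely, let F be in the signed cohomology.  The vertical edges allow
    the difference of its two components to be written F(w) - F(w') = a g(w),
    where w' is the copy of w.
    The main point ([edge_ok_cancel], [HTs_quotient]) is that g inherits every
    edge condition satisfied by both components of F.  For an edge (i,j) other
    than (d1,d), the labels x_i - x_j and a are linear forms that are not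
    proportional, so a cancels modulo x_i - x_j ([eqmodp_XB_cancel]); for the
    edges (d1,d), the condition modulo a^2 says exactly that g(w) and g(w tau)
    agree modulo a.

    - For [phi + psi_shriek]: take f to be the second component of F.  The
      second component of F - phi(f) vanishes, so its first component is a g
      with g satisfying the conditions of h, and F = phi(f) + psi_shriek(g).
    - For [eta + rho_shriek]: since b - c = -a, subtracting rho_shriek(-g) from
      F makes both components equal.  Their common value satisfies the
      conditions of h and of the copy graph, that is, those of h_+.

    Injectivity in both cases only uses that a is not zero. *)

(** * Congruences *)

Section Congruences.
Variable A : comNzRingType.
Implicit Types a b p q r s : A.

Lemma eqmodp_refl a p : eqmodp a p p.
Proof. by exists 0; rewrite subrr mul0r. Qed.

Lemma eqmodp_sym a p q : eqmodp a p q -> eqmodp a q p.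
Proof. by case=> c e; exists (- c); rewrite -opprB e mulNr. Qed.

Lemma eqmodpD a p q r s :
  eqmodp a p q -> eqmodp a r s -> eqmodp a (p + r) (q + s).
Proof. by move=> [c e] [c' e']; exists (c + c'); rewrite mulrDl -e -e'; ring. Qed.

Lemma eqmodpB a p q r s :
  eqmodp a p q -> eqmodp a r s -> eqmodp a (p - r) (q - s).
Proof. by move=> [c e] [c' e']; exists (c - c'); rewrite mulrBl -e -e'; ring. Qed.

Lemma eqmodpM a p q r s :
  eqmodp a p q -> eqmodp a r s -> eqmodp a (p * r) (q * s).
Proof.
move=> [c e] [c' e']; exists (c * r + q * c').
by rewrite mulrDl mulrAC -e -mulrA -e'; ring.
Qed.

Lemma eqmodpN a p q : eqmodp a p q -> eqmodp (- a) p q.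
Proof. by case=> c e; exists (- c); rewrite e mulrNN. Qed.

Lemma eqmodp_mull a p : eqmodp a (a * p) 0.
Proof. by exists p; rewrite subr0 mulrC. Qed.

Lemma eqmodp_prod a (I : Type) (e : seq I) (F G : I -> A) :
  (forall i, eqmodp a (F i) (G i)) ->
  eqmodp a (\prod_(i <- e) F i) (\prod_(i <- e) G i).
Proof.
move=> FG; apply: (big_ind2 (eqmodp a)) => //; first exact: eqmodp_refl.
by move=> *; exact: eqmodpM.
Qed.

Lemma eqmodp_sum a (I : Type) (e : seq I) (F G : I -> A) :
  (forall i, eqmodp a (F i) (G i)) ->
  eqmodp a (\sum_(i <- e) F i) (\sum_(i <- e) G i).
Proof.
move=> FG; apply: (big_ind2 (eqmodp a)) => //; first exact: eqmodp_refl.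
by move=> *; exact: eqmodpD.
Qed.

End Congruences.

(** * Differences of variables *)

Section LinearForms.
Variables (A : idomainType) (n : nat).
Implicit Types (a b c e : 'I_n) (p : {mpoly A[n]}).

Lemma mpolyXU_inj : injective (fun a => 'X_a : {mpoly A[n]}).
Proof.
move=> a b /(congr1 (mcoeff U_(a)%MM)) /eqP.
by rewrite !mcoeffXU eqxx; case: (b =P a) => // _; rewrite oner_eq0.
Qed.

Definition identify a b : 'I_n -> 'I_n := fun i => if i == a then b else i.

Definition msubst (f : 'I_n -> 'I_n) p : {mpoly A[n]} :=
  p \mPo [tuple 'X_(f i) | i < n].

Lemma msubstXU f a : msubst f 'X_a = 'X_(f a).
Proof. by rewrite /msubst comp_mpolyXU -tnth_nth tnth_mktuple. Qed.

(** Substituting X_b for X_a realizes the quotient by X_a - X_b inside the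
    polynomial ring itself, which makes it visibly a domain. *)
Lemma msubst_identify a b p : eqmodp ('X_a - 'X_b) p (msubst (identify a b) p).
Proof.
rewrite {1}(mpolyE p) /msubst comp_mpolyE; apply: eqmodp_sum => m.
rewrite -!mul_mpolyC; apply: eqmodpM; first exact: eqmodp_refl.
rewrite [X in eqmodp _ X _]mpolyXE_id.
apply: eqmodp_prod => i; rewrite tnth_mktuple.
elim: (m i) => [|k IH]; first by rewrite !expr0; exact: eqmodp_refl.
rewrite !exprS; apply: eqmodpM => //; rewrite /identify; case: eqP => [->|_].
  by exists 1; rewrite mul1r.
exact: eqmodp_refl.
Qed.

(** X_c - X_e remains nonzero after X_a and X_b have been identified, and the
    quotient by X_a - X_b is a domain. *)
Lemma eqmodp_XB_cancel {a b c e p} : c != e ->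
  ~~ ((c == a) && (e == b)) -> ~~ ((c == b) && (e == a)) ->
  eqmodp ('X_a - 'X_b) (('X_c - 'X_e) * p) 0 -> eqmodp ('X_a - 'X_b) p 0.
Proof.
move=> ce cab eab [q]; rewrite subr0 => /(congr1 (msubst (identify a b))).
rewrite /msubst !rmorphM !rmorphB /= -!/(msubst _ _) !msubstXU.
have -> : identify a b a = identify a b b.
  by rewrite /identify eqxx; case: eqP.
rewrite subrr mulr0 => /eqP; rewrite mulf_eq0 subr_eq0 => /orP[/eqP/mpolyXU_inj|/eqP p0].
  move: ce cab eab; rewrite /identify.
  by case: (c =P a) => ca; case: (e =P a) => ea + + + E; subst; rewrite ?eqxx.
by rewrite -p0; exact: msubst_identify.
Qed.

End LinearForms.

(** * Edge conditions on functions on the symmetric group *)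

Section EdgeConditions.
Variables (R : realType) (n : nat).
Implicit Types (F G : 'S_n -> HBT R n) (i j k l : 'I_n) (w s : 'S_n).

Definition edge_ok F i j : Prop :=
  forall w, eqmodp (tdiff R w i j) (F w) (F (w \oS tperm i j)).

Lemma HT_perm_graphP (P : rel 'I_n) (f : cochain R n (perm_graph R P)) :
  HT f <-> forall i j, P i j -> edge_ok f i j.
Proof.
split=> [Hf i j Pij w|Hf [w i j Pij]]; last exact: Hf.
exact: (Hf (PermEdge w Pij)).
Qed.

Lemma tdiffN w i j : tdiff R w i j = - tdiff R w j i.
Proof. by rewrite /tdiff opprB. Qed.

Lemma tdiff_neq0 w i j : i != j -> tdiff R w i j != 0.
Proof. by rewrite subr_eq0; apply: contra => /eqP/mpolyXU_inj/perm_inj ->. Qed.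

Lemma edge_okC F i j : edge_ok F i j -> edge_ok F j i.
Proof. by move=> H w; rewrite tdiffN tpermC; apply: eqmodpN. Qed.

Lemma permc_tpermK w i j : w \oS tperm i j \oS tperm i j = w.
Proof. by rewrite -permcA /permc tperm2 mul1g. Qed.

Lemma edge_ok_eq F G i j : F =1 G -> edge_ok F i j -> edge_ok G i j.
Proof. by move=> FG H w; rewrite -!FG. Qed.

Lemma edge_okB F G i j :
  edge_ok F i j -> edge_ok G i j -> edge_ok (fun w => F w - G w) i j.
Proof. by move=> HF HG w; apply: eqmodpB. Qed.

Lemma edge_okM F G i j :
  edge_ok F i j -> edge_ok G i j -> edge_ok (fun w => F w * G w) i j.
Proof. by move=> HF HG w; apply: eqmodpM. Qed.

(** Along the edge (i,j), each variable X_(w k) is either fixed or exchanged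
    with the other endpoint of the label. *)
Lemma edge_ok_tdiff i j k l : edge_ok (fun w => tdiff R w k l) i j.
Proof.
suff X k' : edge_ok (fun w => 'X_(w k')) i j by apply: edge_okB.
move=> w; rewrite permcE; case: tpermP => [->|->|_ _].
- by exists 1; rewrite mul1r.
- by exists (-1); rewrite mulN1r opprB.
- exact: eqmodp_refl.
Qed.

Lemma edge_ok_tdiffM F i j : edge_ok (fun w => tdiff R w i j * F w) i j.
Proof.
move=> w; rewrite tdiff_tperm.
by exists (F w + F (w \oS tperm i j)); ring.
Qed.

(** Since w (i,j) s = w s (s^-1 i, s^-1 j), right translation by s relabels the
    positions of the edges. *)
Lemma edge_ok_permc F s i j :
  edge_ok F i j -> edge_ok (fun w => F (w \oS s)) (s i) (s j).
Proof.
move=> H w; have := H (w \oS s).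
rewrite /tdiff !permcE -tpermJ; congr eqmodp; congr F.
by rewrite /permc /conjg !mulgA mulgV mul1g.
Qed.

(** The label of the edges (k,l) can be divided out.  For an edge (i,j) other
    than (k,l) this is coprimality of the labels.  For (k,l) itself coprimality
    fails, but the label changes sign under (k,l), so the congruence modulo its
    square reads label * (F w - F (w (k,l))) = 0 modulo label^2. *)
Lemma edge_ok_cancel k l F i j : k != l ->
  (forall w, eqmodp (tdiff R w k l ^+ 2)
     (tdiff R w k l * F w
      + tdiff R (w \oS tperm k l) k l * F (w \oS tperm k l)) 0) ->
  edge_ok (fun w => tdiff R w k l * F w) i j -> edge_ok F i j.
Proof.
move=> kl sq H.
have kl_ok : edge_ok F k l.
  move=> w; have [c] := sq w; rewrite tdiff_tperm subr0 => E; exists c.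
  by apply: (mulfI (tdiff_neq0 w kl)); rewrite mulrCA -expr2 -E; ring.
have [/andP[/eqP<- /eqP<-] //|not_kl] := boolP ((k == i) && (l == j)).
have [/andP[/eqP<- /eqP<-]|not_lk] := boolP ((k == j) && (l == i)).
  exact: edge_okC.
move=> w; suff [c] : eqmodp (tdiff R w i j) (F w - F (w \oS tperm i j)) 0.
  by rewrite subr0 => E; exists c.
apply: (@eqmodp_XB_cancel _ _ (w i) (w j) (w k) (w l));
  rewrite ?(inj_eq perm_inj) // -/(tdiff R w k l) -/(tdiff R w i j).
have [c E] := H w; have [c' E'] := edge_ok_tdiff i j k l w.
exists (c - c' * F (w \oS tperm i j)).
rewrite [RHS](_ : _ = c * tdiff R w i j
                      - c' * tdiff R w i j * F (w \oS tperm i j)); last by ring.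
by rewrite -E -E'; ring.
Qed.

Lemma tdiff_factor k l F :
  (forall w, eqmodp (tdiff R w k l) (F w) 0) ->
  exists g : {ffun 'S_n -> HBT R n}, forall w, F w = tdiff R w k l * g w.
Proof.
move=> /choice[g Eg]; exists (finfun g) => w.
by rewrite ffunE -[LHS]subr0 Eg mulrC.
Qed.

End EdgeConditions.

(** * Edges of the Hessenberg graphs *)

Section Hessenberg.
Variables (n : nat) (h : 'I_n -> 'I_n) (d0 d d1 : 'I_n).
Hypotheses (hessh : hessenberg h) (lt_d0d : (d0 < d)%N) (d1E : d1 = d.+1 :> nat).
Hypotheses (hd : h d = h d1) (hpre : (h @^-1` [set d] = [set d0])%classic).

Let rel_O : rel 'I_n := fun i j =>
  hess_rel (h_minus h d0 d) i j || ((i == d1) && (j == d0)).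

(* With the monotonicity of h, this puts h j < d for j < d0 and d < h j for
   j > d0: it is how the hypothesis on h^-1(d) enters everything below. *)
Let h_eqd j : (h j == d) = (j == d0).
Proof.
have -> : (h j == d) = `[< (h @^-1` [set d])%classic j >].
  by apply/eqP/asboolP.
by rewrite hpre; apply/asboolP/eqP.
Qed.

Let d1_neq_d : d1 != d.
Proof. by rewrite -val_eqE /= d1E; lia. Qed.

Let d1_neq_d0 : d1 != d0.
Proof. by rewrite -val_eqE /= d1E; lia. Qed.

Let h_d0 : h d0 = d.
Proof. by apply/eqP; rewrite h_eqd. Qed.

Lemma hess_relE i j :
  hess_rel h i j = hess_rel (h_minus h d0 d) i j || ((i == d) && (j == d0)).
Proof.
rewrite /hess_rel /h_minus; case: (j =P d0) => [->|_]; last by rewrite andbF orbF.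
by rewrite h_d0 -!val_eqE /=; move: lt_d0d; clear; lia.
Qed.

Lemma hess_rel_plusE i j : hess_rel (h_plus h d0 d1) i j =
  [|| hess_rel (h_minus h d0 d) i j, (i == d) && (j == d0)
    | (i == d1) && (j == d0)].
Proof.
rewrite /hess_rel /h_minus /h_plus; case: (j =P d0) => [->|_].
  by rewrite -!val_eqE /= d1E; lia.
by rewrite !andbF !orbF.
Qed.

Lemma hess_rel_minus_d1d : hess_rel (h_minus h d0 d) d1 d.
Proof.
have [_ ge_h] := hessh.
have dd0 : (d == d0) = false by rewrite -val_eqE /=; lia.
have := ge_h d; rewrite leq_eqVlt val_eqE eq_sym h_eqd dd0 /= => lt.
by rewrite /hess_rel /h_minus dd0 d1E ltnSn.
Qed.

(** Call column j the set of edges (i,j) with j < i <= h j.  The edges of h_-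
    are stable under (d1,d): columns before d0 stop below d,
    columns strictly between d0 and d contain both d and d1, and the columns d
    and d1 end at the same height as h d = h d1.  The remaining edge (d,d0) of h
    goes to (d1,d0).  The orientation of an edge may be reversed: this happens
    for (d1,d). *)
Lemma hess_rel_tperm i j : hess_rel h i j ->
  rel_O (tperm d1 d i) (tperm d1 d j) || rel_O (tperm d1 d j) (tperm d1 d i).
Proof.
have [mono_h ge_h] := hessh.
have lt_h (k : 'I_n) : (k < d0)%N -> (h k < d)%N.
  move=> lt; rewrite ltn_neqAle val_eqE h_eqd -val_eqE /=.
  by apply/andP; split; [lia | rewrite -h_d0 mono_h; lia].
have gt_h (k : 'I_n) : (d0 < k)%N -> (d < h k)%N.
  move=> lt; rewrite ltn_neqAle eq_sym val_eqE h_eqd -val_eqE /=.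
  by apply/andP; split; [lia | rewrite -h_d0 mono_h; lia].
have := hess_rel_minus_d1d.
rewrite /rel_O /hess_rel /h_minus.
have E : (h d = h d1 :> nat) by rewrite hd.
have E0 : (h d0 = d :> nat) by rewrite h_d0.
have dd0 : (d == d0) = false by rewrite -val_eqE /=; lia.
have neq (x y : 'I_n) : x <> y -> (x : nat) <> y by move=> xy /val_inj.
case: (tpermP d1 d i) => [->|->|/neq i1 /neq i2];
  case: (tpermP d1 d j) => [->|->|/neq j1 /neq j2];
  rewrite ?(negbTE d1_neq_d0) ?dd0 ?eqxx ?andbF ?orbF;
  have := gt_h d; have := gt_h d1;
  try (case: (j =P d0) => [->|/neq jd0]; last (have := lt_h j; have := gt_h j));
  try (case: (i =P d0) => [->|/neq id0]; last (have := lt_h i; have := gt_h i));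
  rewrite ?eqxx ?h_d0 -?val_eqE /=; try lia.
Qed.

End Hessenberg.

(** * Bijectivity of the two maps *)

Section Isomorphisms.
Variables (R : realType) (n : nat) (h : 'I_n -> 'I_n) (d0 d d1 : 'I_n).
Hypotheses (hessh : hessenberg h) (lt_d0d : (d0 < d)%N) (d1E : d1 = d.+1 :> nat).
Hypotheses (hd : h d = h d1) (hpre : (h @^-1` [set d] = [set d0])%classic).

Let hm := h_minus h d0 d.
Let hp := h_plus h d0 d1.
Let tau := tperm d1 d.
Let HTsF : set {ffun 'S_n + 'S_n -> HBT R n} :=
  @HTsub R n (graphT R h d0 d d1) (@tilde_cond R n h d0 d d1).

Let d1_neq_d : d1 != d.
Proof. by rewrite -val_eqE /= d1E; lia. Qed.

Let hE := hess_relE lt_d0d hpre.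
Let hpE := hess_rel_plusE h lt_d0d d1E.
Let hm_d1d := hess_rel_minus_d1d hessh lt_d0d d1E hpre.

Lemma HTsP (F : {ffun 'S_n + 'S_n -> HBT R n}) : HTsF F <->
  [/\ forall i j, hess_rel h i j -> edge_ok (fun w => F (inl w)) i j,
      forall i j, hess_rel hm i j || ((i == d1) && (j == d0)) ->
        edge_ok (fun w => F (inr w)) i j,
      forall w, eqmodp (tdiff R w d1 d) (F (inl w)) (F (inr w))
    & @tilde_cond R n h d0 d d1 F].
Proof.
split=> [[HF cF]|[Hl Hr Hv cF]].
  split=> // [i j Pij w|i j Pij w|w].
  - exact: (HF (inl (inl (PermEdge w Pij)))).
  - exact: (HF (inl (inr (PermEdge w Pij)))).
  - exact: (HF (inr w)).
by split=> // -[[[w i j Pij]|[w i j Pij]]|w]; [exact: Hl|exact: Hr|exact: Hv].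
Qed.

Lemma HTsB F G : HTsF F -> HTsF G -> HTsF (F - G).
Proof.
move=> HF HG; rewrite addrC -scaleN1r.
exact: (HTsubP (@tilde_condP R n h d0 d d1) (-1) HG HF).
Qed.

Lemma HTsD F G : HTsF F -> HTsF G -> HTsF (F + G).
Proof.
move=> HF HG; rewrite -[F]scale1r.
exact: (HTsubP (@tilde_condP R n h d0 d d1) 1 HF HG).
Qed.

Lemma hess_rel_minus_sub i j : hess_rel hm i j -> hess_rel h i j.
Proof. by move=> Pij; rewrite hE Pij. Qed.

Lemma phi_HTs (f : cochain R n (graphO R h d0 d d1)) :
  HT f -> HTsF (phi d d1 f).
Proof.
move/HT_perm_graphP => Hf; apply/HTsP; split=> [i j Pij|i j Pij|w|w].
- apply: (@edge_ok_eq _ _ (fun w => f (w \oS tau))) => [w|].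
    by rewrite ffunE.
  rewrite -(tpermK d1 d i) -(tpermK d1 d j); apply: edge_ok_permc.
  have /orP[|] := hess_rel_tperm hessh lt_d0d d1E hd hpre Pij.
    exact: Hf.
  by move=> ?; apply: edge_okC; exact: Hf.
- by apply: (@edge_ok_eq _ _ f) => [w|]; [rewrite ffunE | exact: Hf].
- rewrite !ffunE; apply: eqmodp_sym; apply: Hf.
  by rewrite hm_d1d.
- by rewrite !ffunE permc_tpermK; exists 0; ring.
Qed.

Lemma psi_HTs (g : cochain R n (graphX R h)) :
  HT g -> HTsF (psi_shriek d d1 g).
Proof.
move/HT_perm_graphP => Hg; apply/HTsP; split=> [i j Pij|i j Pij|w|w].
- apply: (@edge_ok_eq _ _ (fun w => tdiff R w d1 d * g w)) => [w|].
    by rewrite ffunE.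
  by apply: edge_okM; [exact: edge_ok_tdiff | exact: Hg].
- by move=> w; rewrite !ffunE; exact: eqmodp_refl.
- by rewrite !ffunE; exact: eqmodp_mull.
- have [c E] := Hg _ _ (hess_rel_minus_sub hm_d1d) w.
  exists c; rewrite !ffunE tdiff_tperm expr2 mulrA -E; ring.
Qed.

Lemma eta_HTs (f : cochain R n (graphX R hp)) : HT f -> HTsF (eta f).
Proof.
move/HT_perm_graphP => Hf; apply/HTsP; split=> [i j Pij|i j Pij|w|w].
- apply: (@edge_ok_eq _ _ f) => [w|]; first by rewrite ffunE.
  by apply: Hf; move: Pij; rewrite hpE hE orbA => ->.
- apply: (@edge_ok_eq _ _ f) => [w|]; first by rewrite ffunE.
  by apply: Hf; move: Pij; rewrite hpE orbCA => ->; rewrite orbT.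
- by rewrite !ffunE; exact: eqmodp_refl.
- by rewrite !ffunE; exists 0; ring.
Qed.

Lemma rho_HTs (g : cochain R n (graphX R hm)) :
  HT g -> HTsF (rho_shriek d0 d d1 g).
Proof.
move/HT_perm_graphP => Hg; apply/HTsP; split=> [i j|i j|w|w].
- rewrite hE => Pij.
  apply: (@edge_ok_eq _ _ (fun w => tdiff R w d d0 * g w)) => [w|].
    by rewrite ffunE.
  case/orP: Pij => [Pij|/andP[/eqP-> /eqP->]]; last exact: edge_ok_tdiffM.
  by apply: edge_okM; [exact: edge_ok_tdiff | exact: Hg].
- move=> Pij.
  apply: (@edge_ok_eq _ _ (fun w => tdiff R w d1 d0 * g w)) => [w|].
    by rewrite ffunE.
  case/orP: Pij => [Pij|/andP[/eqP-> /eqP->]]; last exact: edge_ok_tdiffM.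
  by apply: edge_okM; [exact: edge_ok_tdiff | exact: Hg].
- by exists (- g w); rewrite !ffunE /tdiff; ring.
- have [c E] := Hg _ _ hm_d1d w.
  exists (- c); rewrite !ffunE expr2 mulNr mulrA -E /tdiff !permcE.
  by rewrite tpermL tpermR; ring.
Qed.

(** The vertical edges give divisibility of the difference of the components;
    the condition modulo the square is exactly the hypothesis under which
    [edge_ok_cancel] passes to the quotient. *)
Lemma HTs_quotient F : HTsF F ->
  exists2 g : {ffun 'S_n -> HBT R n},
    forall w, F (inl w) - F (inr w) = tdiff R w d1 d * g w
  & forall i j, edge_ok (fun w => F (inl w)) i j ->
      edge_ok (fun w => F (inr w)) i j -> edge_ok g i j.
Proof.
case/HTsP => _ _ Fv cF.
have [w|g Eg] := @tdiff_factor R n d1 d (fun w => F (inl w) - F (inr w)).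
  by have [c E] := Fv w; exists c; rewrite subr0.
exists g => // i j Fl Fr; apply: (edge_ok_cancel d1_neq_d) => [w|].
  by have := cF w; rewrite -addrA !Eg.
by apply: (edge_ok_eq Eg); exact: edge_okB.
Qed.

Lemma phi_psi_bij : set_bij
  [set x | @HT R n (graphO R h d0 d d1) x.1 /\ @HT R n (graphX R h) x.2]%classic
  HTsF (fun x => phi d d1 x.1 + psi_shriek d d1 x.2).
Proof.
split.
- by move=> [f g] [/= Hf Hg]; apply: HTsD; [exact: phi_HTs | exact: psi_HTs].
- move=> [f g] [f' g'] _ _ /ffunP /= E.
  have Ef : f = f'.
    by apply/ffunP => w; have := E (inr w); rewrite !ffunE !addr0.
  congr pair => //; apply/ffunP => w; have := E (inl w).
  by rewrite !ffunE Ef => /addrI /(mulfI (tdiff_neq0 R w d1_neq_d)).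
- move=> F HF; pose f : {ffun 'S_n -> HBT R n} := [ffun w => F (inr w)].
  have Hf : @HT R n (graphO R h d0 d d1) f.
    apply/HT_perm_graphP => i j Pij; apply: (@edge_ok_eq _ _ (fun w => F (inr w))).
      by move=> w; rewrite [RHS]ffunE.
    by case/HTsP: HF => _ + _ _; apply.
  have HF' := HTsB HF (phi_HTs Hf).
  have Er w : (F - phi d d1 f) (inr w) = 0 by rewrite !ffunE subrr.
  have [g Eg Hg] := HTs_quotient HF'.
  exists (f, g).
    split=> //=; apply/HT_perm_graphP => i j Pij.
    case/HTsP: HF' => /(_ i j Pij) Fl _ _ _; apply: Hg => //.
    by move=> w; rewrite !Er; exact: eqmodp_refl.
  apply/ffunP => -[w|w] /=; rewrite [LHS]ffunE [X in _ + X]ffunE.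
    by rewrite -Eg Er subr0 [X in _ + X]ffunE [X in _ + (_ + X)]ffunE addrC subrK.
  by rewrite addr0 !ffunE.
Qed.

Lemma eta_rho_bij : set_bij
  [set x | @HT R n (graphX R hp) x.1 /\ @HT R n (graphX R hm) x.2]%classic
  HTsF (fun x => eta x.1 + rho_shriek d0 d d1 x.2).
Proof.
split.
- by move=> [f g] [/= Hf Hg]; apply: HTsD; [exact: eta_HTs | exact: rho_HTs].
- move=> [f g] [f' g'] _ _ /ffunP /= E.
  have Eg : g = g'.
    apply/ffunP => w; apply: (mulfI (tdiff_neq0 R w d1_neq_d)).
    have := E (inl w); have := E (inr w); rewrite !ffunE => Er El.
    (* x_d1 - x_d is the difference of the two factors used by rho_shriek. *)
    have split_d1d (p q : HBT R n) : tdiff R w d1 d * q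
        = (p + tdiff R w d1 d0 * q) - (p + tdiff R w d d0 * q).
      by rewrite /tdiff; ring.
    by rewrite (split_d1d (f w)) (split_d1d (f' w)) El Er.
  congr pair => //; apply/ffunP => w; have := E (inl w).
  by rewrite !ffunE Eg => /addIr.
- move=> F HF; have [g Eg Hg] := HTs_quotient HF.
  case/HTsP: (HF) => Fl Fr _ _.
  (* b - c = -a, so the difference a g of the components is that of rho(-g). *)
  pose f_ : {ffun 'S_n -> HBT R n} := [ffun w => - g w].
  have Hf_ : @HT R n (graphX R hm) f_.
    apply/HT_perm_graphP => i j Pij.
    apply: (@edge_ok_eq _ _ (fun w => 0 - g w)) => [w|].
      by rewrite ffunE sub0r.
    apply: edge_okB; first by move=> w; exact: eqmodp_refl.
    by apply: Hg; [apply: Fl; exact: hess_rel_minus_sub | apply: Fr; rewrite Pij].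
  have HF' := HTsB HF (rho_HTs Hf_).
  set F' := F - rho_shriek d0 d d1 f_ in HF'.
  have F'rl w : F' (inr w) = F' (inl w).
    rewrite !ffunE; apply/eqP; rewrite -subr_eq0.
    rewrite [F (inl w)](_ : _ = F (inr w) + tdiff R w d1 d * g w).
      by rewrite /tdiff; apply/eqP; ring.
    by rewrite -Eg addrC subrK.
  pose f : {ffun 'S_n -> HBT R n} := [ffun w => F' (inl w)].
  case/HTsP: HF' => F'l F'r _ _.
  exists (f, f_).
    split=> //=; apply/HT_perm_graphP => i j.
    rewrite hpE => Pij.
    have [Ph|Nh] := boolP (hess_rel h i j).
      by apply: (edge_ok_eq _ (F'l _ _ Ph)) => w; rewrite [RHS]ffunE.
    apply: (edge_ok_eq _ (F'r i j _)) => [w|]; first by rewrite [RHS]ffunE F'rl.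
    move: Pij Nh; rewrite hE orbA.
    by case: (hess_rel _ _ _ || _) => //= ->; rewrite orbT.
  have F'D v : F' v + rho_shriek d0 d d1 f_ v = F v.
    by rewrite [F' v]ffunE [X in F v + X]ffunE subrK.
  apply/ffunP => -[w|w] /=; rewrite -[RHS]F'D [LHS]ffunE; congr (_ + _).
    by rewrite [LHS]ffunE [LHS]ffunE.
  by rewrite F'rl [LHS]ffunE [LHS]ffunE.
Qed.

End Isomorphisms.

(** * Linearity, equivariance, degrees, and the isomorphisms *)

Section Equivariance.
Variables (R : realType) (n : nat) (h : 'I_n -> 'I_n) (d0 d d1 : 'I_n).

Lemma msym_tdiffV (s w : 'S_n) i j :
  msym s (tdiff R (s^-1%g \oS w) i j) = tdiff R w i j.
Proof. by rewrite msym_tdiff permcA /permc mulVg mulg1. Qed.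

Lemma phi_psi_linear a (x y : gamb (gsum (HO R h d0 d d1) (gshift (HX R h)))) :
  phi_psi (a *: x + y) = a *: phi_psi x + phi_psi y.
Proof.
case: x y => [f g] [f' g'].
apply/ffunP => -[w|w]; rewrite !ffunE /=.
  by rewrite mulrDr scalerDr -scalerAr addrACA.
by rewrite !addr0.
Qed.

Lemma phi_psi_msym s (x : gamb (gsum (HO R h d0 d d1) (gshift (HX R h)))) :
  phi_psi (Defs.gact s x) = Defs.gact s (phi_psi x).
Proof.
case: x => [f g]; apply/ffunP => -[w|w]; rewrite !ffunE /=.
  by rewrite msymD msymM msym_tdiffV permcA.
by rewrite !addr0.
Qed.

Lemma phi_psi_homog k (x : gamb (gsum (HO R h d0 d d1) (gshift (HX R h)))) :
  gdeg k x -> homogeneous k (phi_psi x).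
Proof.
case: x => [f g] [/= [_ Hf] Hg] [w|w]; rewrite !ffunE; last by rewrite addr0; exact: Hf.
rewrite rpredD //; first exact: Hf.
case: k Hg {Hf} => [->|k [_ Hg]].
  by rewrite ffunE mulr0 rpred0.
exact: (dhomogM (tdiff_deg R w d1 d) (Hg w)).
Qed.

Lemma eta_rho_linear a
    (x y : gamb (gsum (HX R (h_plus h d0 d1)) (gshift (HX R (h_minus h d0 d))))) :
  @eta_rho R n h d0 d d1 (a *: x + y) = a *: eta_rho x + eta_rho y.
Proof.
case: x y => [f g] [f' g'].
by apply/ffunP => -[w|w]; rewrite !ffunE /= mulrDr scalerDr -scalerAr addrACA.
Qed.

Lemma eta_rho_msym s
    (x : gamb (gsum (HX R (h_plus h d0 d1)) (gshift (HX R (h_minus h d0 d))))) :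
  @eta_rho R n h d0 d d1 (Defs.gact s x) = Defs.gact s (eta_rho x).
Proof.
case: x => [f g]; apply/ffunP => -[w|w]; rewrite !ffunE /=;
  by rewrite msymD msymM msym_tdiffV.
Qed.

Lemma eta_rho_homog k
    (x : gamb (gsum (HX R (h_plus h d0 d1)) (gshift (HX R (h_minus h d0 d))))) :
  gdeg k x -> homogeneous k (@eta_rho R n h d0 d d1 x).
Proof.
case: x => [f g] [/= [_ Hf] Hg] [w|w]; rewrite !ffunE;
  (rewrite rpredD //; first exact: Hf); case: k Hg {Hf} => [->|k [_ Hg]];
  rewrite ?ffunE ?mulr0 ?rpred0 //.
- exact: (dhomogM (tdiff_deg R w d d0) (Hg w)).
- exact: (dhomogM (tdiff_deg R w d1 d0) (Hg w)).
Qed.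

End Equivariance.

Theorem theorem5p1 (R : realType) (n : nat) (h : 'I_n -> 'I_n)
    (d0 d d1 : 'I_n) (hessh : hessenberg h)
    (lt_d0d : (d0 < d)%N) (d1E : d1 = d.+1 :> nat)
    (hd : h d = h d1) (hpre : (h @^-1` [set d] = [set d0])%classic) :
  gSn_isomorphism (@phi_psi R n h d0 d d1) /\
  gSn_isomorphism (@eta_rho R n h d0 d d1).
Proof.
have bij1 := phi_psi_bij R hessh lt_d0d d1E hd hpre.
have bij2 := eta_rho_bij R hessh lt_d0d d1E hpre.
split; split.
- by move=> a x y _ _; exact: phi_psi_linear.
- by move=> s x _; exact: phi_psi_msym.
- move=> k x Hx; split; last exact: phi_psi_homog.
  by case: bij1 => im _ _; apply: im; have [] := gdeg_sub Hx.
- exact: bij1.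
- by move=> a x y _ _; exact: eta_rho_linear.
- by move=> s x _; exact: eta_rho_msym.
- move=> k x Hx; split; last exact: eta_rho_homog.
  by case: bij2 => im _ _; apply: im; have [] := gdeg_sub Hx.
- exact: bij2.
Qed.
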